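(* Let $N_1,N_2$ be labeled Petri nets, $C_1,C_2$ Presburger formulas over the places of $N_1$ and $N_2$ respectively, and $E$ a Presburger formula with free variables in $P_1\cup P_2$. For $i=1,2$ let $\tau^*_{C_i}$ be a Presburger formula such that for every marking $m\models C_i$ of $N_i$ and every marking $m'$ of $N_i$, $\tau^*_{C_i}(m,m')$ holds iff $m\xRightarrow{\epsilon}m'$ in $N_i$. Suppose that: (Core 0) for each $i\in\{1,2\}$ the formula $\forall\vec p,\vec p',a.\ C_i(\vec p)\wedge\overleftarrow{T}_{C_i}(\vec p,\vec p',a)\implies\exists\vec p''.\ C_i(\vec p'')\wedge\overleftarrow{T}_{C_i}(\vec p,\vec p'',a)\wedge\tau^*_{C_i}(\vec p'',\vec p')$ (built from $N_i$) is valid; (Core 1) $\forall\vec x.\ C_1(\vec x)\implies\exists\vec y.\ \tilde E(\vec x,\vec y)\wedge C_2(\vec y)$ is valid; (Core 2) $\forall\vec p_1,\vec p_2,\vec p_1'.\ \tilde E(\vec p_1,\vec p_2)\wedge\tau_1(\vec p_1,\vec p_1')\implies\tilde E(\vec p_1',\vec p_2)$ is valid; (Core 3) $\forall\vec p_1,\vec p_2,a,\vec p_1',\vec p_2'.\ C_1(\vec p_1)\wedge\tilde E(\vec p_1,\vec p_2)\wedge C_2(\vec p_2)\wedge\hat T_{C_1}(\vec p_1,\vec p_1',a)\wedge\tilde E(\vec p_1',\vec p_2')\implies\hat T_{C_2}(\vec p_2,\vec p_2',a)$ is valid. Then $(N_1,C_1)$ and $(N_2,C_2)$ are coherent nets and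 $(N_1,C_1)\preceq_E(N_2,C_2)$.
   Context: A labeled Petri net $N=(P,T,\mathrm{Pre},\mathrm{Post})$ has finite place set $P=\{p_1,\dots,p_n\}$, finite transition set $T$, $\mathrm{Pre},\mathrm{Post}:T\to(P\to\mathbb N)$, and labeling $l:T\to\Sigma\cup\{\tau\}$, $\tau$ silent. Labels are encoded as natural numbers: $\Sigma\subseteq\mathbb N\setminus\{0\}$, $\tau$ encoded by $0$. Markings $m:P\to\mathbb N$ are identified with vectors. $t$ is enabled at $m$ if $m\ge\mathrm{Pre}(t)$, and then $m\xrightarrow{t}m'$ with $m'=m-\mathrm{Pre}(t)+\mathrm{Post}(t)$; $m\xRightarrow{\varrho}m'$ is firing along $\varrho\in T^*$. Extend $l$ to $T^*$ by erasing $\tau$. For $\sigma\in\Sigma^*$, $m\xRightarrow{\sigma}m'$ means some $\varrho$ with $l(\varrho)=\sigma$ has $m\xRightarrow{\varrho}m'$ ($m\xRightarrow{\epsilon}m'$: silent reachability). $m\overset{\epsilon}{\twoheadrightarrow}m'$ iff $m=m'$; for $\sigma\in\Sigma^*,a\in\Sigma$, $m\overset{\sigma a}{\twoheadrightarrow}m'$ iff there exist $m''$, $t$ with $l(t)=a$ and $m\xRightarrow{\sigma}m''\xrightarrow{t}m'$. $(N,C)$ is a coherent net if for every $m\models C$, $\sigma\in\Sigma^*$, $m\xRightarrow{\sigma}m'$ there is $m''\models C$ with $m\overset{\sigma}{\twoheadrightarrow}m''$ and $m''\xRightarrow{\epsilon}m'$. For a net $N$: $\mathrm{ENBL}_t(\vec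 x)\triangleq\bigwedge_i x_i\ge\mathrm{Pre}(t,p_i)$; $\Delta_t(\vec x,\vec x')\triangleq\bigwedge_i x_i'=x_i+\mathrm{Post}(t,p_i)-\mathrm{Pre}(t,p_i)$; $T(\vec x,\vec x',a)\triangleq\bigvee_{t\in T,\,l(t)\ne\tau}(\mathrm{ENBL}_t\wedge\Delta_t\wedge a=l(t))$; $\tau(\vec x,\vec x')\triangleq\bigvee_{t\in T,\,l(t)=\tau}(\mathrm{ENBL}_t(\vec x)\wedge\Delta_t(\vec x,\vec x'))$ ($\tau_1$ is this formula for $N_1$); $\overleftarrow{T}_C(\vec x,\vec x',a)\triangleq\exists\vec x''.\tau^*_C(\vec x,\vec x'')\wedge T(\vec x'',\vec x',a)$; $\hat T_C(\vec x,\vec x',a)\triangleq(\exists\vec x_1.\overleftarrow{T}_C(\vec x,\vec x_1,a)\wedge C(\vec x_1)\wedge\tau^*_C(\vec x_1,\vec x'))\vee(a=0\wedge\tau^*_C(\vec x,\vec x'))$. All variables range over $\mathbb N$ and ''valid'' means true for all assignments. $\tilde E(\vec x,\vec y)$ is $E$ with places of $N_1$ replaced by variables $\vec x$, places of $N_2$ replaced by $\vec y$ (bound variables renamed apart), conjoined with $x_i=y_j$ whenever place $p^1_i$ of $N_1$ equals place $p^2_j$ of $N_2$. For markings $m_1,m_2$, $m_1\equiv_E m_2$ means $\tilde E(m_1,m_2)$ holds, and $m_1\langle C_1EC_2\rangle m_2$ means $m_1\models C_1$, $m_1\equiv_E m_2$, $m_2\models C_2$. $(N_1,C_1)\preceq_E(N_2,C_2)$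 means: (S1) for every $m_1\models C_1$ there is $m_2$ with $m_1\langle C_1EC_2\rangle m_2$; (S2) for all $m_1\xRightarrow{\epsilon}m_1'$ in $N_1$ and all $m_2$, $m_1\equiv_E m_2$ implies $m_1'\equiv_E m_2$; (S3) for all $\sigma\in\Sigma^*$, $m_1\xRightarrow{\sigma}m_1'$ in $N_1$ and $m_2,m_2'$ with $m_1\langle C_1EC_2\rangle m_2$ and $m_1'\equiv_E m_2'$, we have $m_2\xRightarrow{\sigma}m_2'$ in $N_2$. *)

(* Defs.v *)
From HB Require Import structures.
From mathcomp Require Import all_boot.
From mathcomp Require Import finmap.

Set Implicit Arguments.
Unset Strict Implicit.
Unset Printing Implicit Defensive.

Local Open Scope fset_scope.
Local Open Scope nat_scope.

Inductive pterm (X : Type) : Type :=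
| PVar of X
| PConst of nat
| PAdd of pterm X & pterm X
| PScale of nat & pterm X.

(* [presburger X]: Presburger formulas over the naturals whose free variables
   lie in [X].  A quantifier binds the extra variable [None : option X], so
   renaming free variables never captures. *)
Inductive presburger (X : Type) : Type :=
| PTrue
| PEq of pterm X & pterm X
| PLe of pterm X & pterm X
| PNot of presburger X
| PAnd of presburger X & presburger X
| POr of presburger X & presburger X
| PEx of presburger (option X)
| PAll of presburger (option X).

Arguments PConst {X}.
Arguments PTrue {X}.

Fixpoint teval (X : Type) (e : X -> nat) (u : pterm X) : nat :=
  match u with
  | PVar x => e x
  | PConst k => k
  | PAdd u1 u2 => teval e u1 + teval e u2
  | PScale k u1 => k * teval e u1
  end.

Fixpoint holds (X : Type) (f : presburger X) : (X -> nat) -> Prop :=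
  match f with
  | PTrue => fun=> True
  | PEq u1 u2 => fun e => teval e u1 = teval e u2
  | PLe u1 u2 => fun e => teval e u1 <= teval e u2
  | PNot f1 => fun e => ~ holds f1 e
  | PAnd f1 f2 => fun e => holds f1 e /\ holds f2 e
  | POr f1 f2 => fun e => holds f1 e \/ holds f2 e
  | PEx f1 => fun e => exists k, holds f1 (fun o => if o is Some x then e x else k)
  | PAll f1 => fun e => forall k, holds f1 (fun o => if o is Some x then e x else k)
  end.

Fixpoint trename (X Y : Type) (r : X -> Y) (u : pterm X) : pterm Y :=
  match u with
  | PVar x => PVar (r x)
  | PConst k => PConst k
  | PAdd u1 u2 => PAdd (trename r u1) (trename r u2)
  | PScale k u1 => PScale k (trename r u1)
  end.

Fixpoint prename (X Y : Type) (r : X -> Y) (f : presburger X) : presburger Y :=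
  match f with
  | PTrue => PTrue
  | PEq u1 u2 => PEq (trename r u1) (trename r u2)
  | PLe u1 u2 => PLe (trename r u1) (trename r u2)
  | PNot f1 => PNot (prename r f1)
  | PAnd f1 f2 => PAnd (prename r f1) (prename r f2)
  | POr f1 f2 => POr (prename r f1) (prename r f2)
  | PEx f1 => PEx (prename (omap r) f1)
  | PAll f1 => PAll (prename (omap r) f1)
  end.

(* [holds2 f m m'] is f(m, m') for f in two disjoint vectors of variables. *)
Definition holds2 (X Y : Type) (f : presburger (X + Y)) (m : X -> nat)
    (m' : Y -> nat) : Prop :=
  holds f (fun v => match v with inl x => m x | inr y => m' y end).

(* [V] is the universe of place names, from which different nets may pick
   common places.  Labels are naturals, 0 being the silent label tau. *)
Record net (V : choiceType) (Sigma : nat -> Prop) := Net {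
  places : {fset V};
  trans : finType;
  pre : trans -> {ffun places -> nat};
  post : trans -> {ffun places -> nat};
  lab : trans -> nat;
  labP : forall t, lab t = 0 \/ Sigma (lab t)
}.

Definition in_star (Sigma : nat -> Prop) (s : seq nat) : Prop :=
  forall a, a \in s -> Sigma a.

Section Semantics.
Variables (V : choiceType) (Sigma : nat -> Prop) (N : net V Sigma).

Definition marking := {ffun places N -> nat}.

Definition enabled (m : marking) (t : trans N) : Prop :=
  forall p, pre t p <= m p.

Definition step (m : marking) (t : trans N) (m' : marking) : Prop :=
  enabled m t /\ m' = [ffun p => m p - pre t p + post t p].

Fixpoint fires (m : marking) (rho : seq (trans N)) (m' : marking) : Prop :=
  match rho with
  | [::] => m = m'
  | t :: rho' => exists m'', step m t m'' /\ fires m'' rho' m'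
  end.

Definition word (rho : seq (trans N)) : seq nat :=
  [seq a <- [seq lab t | t <- rho] | a != 0].

Definition weak (m : marking) (s : seq nat) (m' : marking) : Prop :=
  exists rho, word rho = s /\ fires m rho m'.

(* The two-headed arrow: the run ends with its last observable transition. *)
Inductive obs (m : marking) : seq nat -> marking -> Prop :=
| obs_nil : obs m [::] m
| obs_rcons s a m'' t m' :
    in_star Sigma s -> Sigma a -> lab t = a ->
    weak m s m'' -> step m'' t m' -> obs m (rcons s a) m'.

Definition coherent (C : presburger (places N)) : Prop :=
  forall (m : marking) (s : seq nat) (m' : marking),
    holds C m -> in_star Sigma s -> weak m s m' ->
    exists m'' : marking, [/\ holds C m'', obs m s m'' & weak m'' [::] m'].

Definition ENBL (t : trans N) (x : marking) : Prop :=
  forall p, pre t p <= x p.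

(* x' = x + Post - Pre, written without truncated subtraction. *)
Definition Delta (t : trans N) (x x' : marking) : Prop :=
  forall p, x' p + pre t p = x p + post t p.

Definition Tform (x x' : marking) (a : nat) : Prop :=
  exists t : trans N, [/\ lab t <> 0, ENBL t x, Delta t x x' & a = lab t].

Definition tauform (x x' : marking) : Prop :=
  exists t : trans N, [/\ lab t = 0, ENBL t x & Delta t x x'].

Definition is_tau_star (C : presburger (places N))
    (taus : presburger (places N + places N)) : Prop :=
  forall m m' : marking, holds C m -> (holds2 taus m m' <-> weak m [::] m').

Definition Tback (taus : presburger (places N + places N))
    (x x' : marking) (a : nat) : Prop :=
  exists x'' : marking, holds2 taus x x'' /\ Tform x'' x' a.

Definition That (C : presburger (places N))
    (taus : presburger (places N + places N))
    (x x' : marking) (a : nat) : Prop :=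
  (exists x1 : marking, [/\ Tback taus x x1 a, holds C x1 & holds2 taus x1 x'])
  \/ (a = 0 /\ holds2 taus x x').

Definition core0 (C : presburger (places N))
    (taus : presburger (places N + places N)) : Prop :=
  forall (p p' : marking) (a : nat), holds C p /\ Tback taus p p' a ->
    exists p'' : marking,
      [/\ holds C p'', Tback taus p p'' a & holds2 taus p'' p'].

End Semantics.

Section Equivalence.
Variables (V : choiceType) (P1 P2 : {fset V}).

Lemma in_fsetU_right (v : P1 `|` P2) : ~ fsval v \in P1 -> fsval v \in P2.
Proof. by case: v => v /=; rewrite in_fsetU => /orP[]. Qed.

(* A shared place is sent to the x-side; the equalities below make the choice
   immaterial. *)
Definition split_place (v : P1 `|` P2) : P1 + P2 :=
  match @idP (fsval v \in P1) with
  | ReflectT h => inl (FSetSub h)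
  | ReflectF h => inr (FSetSub (in_fsetU_right h))
  end.

Definition tildeE (E : presburger (P1 `|` P2)) : presburger (P1 + P2) :=
  PAnd (prename split_place E)
       (\big[@PAnd _/PTrue]_(q : P1 * P2 | fsval q.1 == fsval q.2)
          PEq (PVar (inl q.1)) (PVar (inr q.2))).

End Equivalence.

Section Abstraction.
Variables (V : choiceType) (Sigma : nat -> Prop) (N1 N2 : net V Sigma).
Variables (C1 : presburger (places N1)) (C2 : presburger (places N2)).
Variable E : presburger (places N1 `|` places N2).

Definition equivE (m1 : marking N1) (m2 : marking N2) : Prop :=
  holds2 (tildeE E) m1 m2.

Definition related (m1 : marking N1) (m2 : marking N2) : Prop :=
  [/\ holds C1 m1, equivE m1 m2 & holds C2 m2].

Definition S1 : Prop :=
  forall m1 : marking N1, holds C1 m1 -> exists m2 : marking N2, related m1 m2.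

Definition S2 : Prop :=
  forall m1 m1' : marking N1, weak m1 [::] m1' ->
  forall m2 : marking N2, equivE m1 m2 -> equivE m1' m2.

Definition S3 : Prop :=
  forall (s : seq nat) (m1 m1' : marking N1), in_star Sigma s ->
  weak m1 s m1' ->
  forall m2 m2' : marking N2, related m1 m2 -> equivE m1' m2' -> weak m2 s m2'.

Definition preceq : Prop := [/\ S1, S2 & S3].

End Abstraction.

(* Main.v *)
Require Import Defs.
From HB Require Import structures.
From mathcomp Require Import all_boot.
From mathcomp Require Import finmap.

Local Open Scope fset_scope.
Local Open Scope nat_scope.

(* Core 0 turns every visible run from a [C]-marking into one passing through a
   [C]-marking right after each observable transition; this gives coherence, and
   in (S3) it lets Core 1 and Core 3 be applied letter by letter: a [C1]-marking
   reached after the letter has a [C2]-partner, which Core 3 shows reachable in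
   the second net. *)

Section NetRuns.
Set Implicit Arguments.
Unset Strict Implicit.
Context {V : choiceType} {Sigma : nat -> Prop} {N : net V Sigma}.
Implicit Types (m : marking N) (t : trans N) (s : seq nat).

(** Enabledness keeps the truncated subtraction in [step] exact, so it can be traded for the
    additive equation of [Delta]. *)
Lemma stepE m t m' : step m t m' <-> ENBL t m /\ Delta t m m'.
Proof.
split=> -[en D]; split=> //.
  by rewrite D => p; rewrite ffunE addnAC subnK.
apply/ffunP => p; rewrite ffunE; apply: (@addIn (pre t p)).
by rewrite D addnAC subnK.
Qed.

Lemma fires_cat m rho1 rho2 m1 m' :
  fires m rho1 m1 -> fires m1 rho2 m' -> fires m (rho1 ++ rho2) m'.
Proof.
elim: rho1 m => [|t rho IH] m /= => [-> //|[m2 [st f1]] f2].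
by exists m2; split=> //; apply: IH.
Qed.

Lemma weak_refl m : weak m [::] m.
Proof. by exists [::]. Qed.

Lemma weak_step m t m' : lab t <> 0 -> step m t m' -> weak m [:: lab t] m'.
Proof.
by move=> /eqP t0 st; exists [:: t]; split; [rewrite /word /= t0 | exists m'].
Qed.

Lemma weak_cat m s1 m1 s2 m' :
  weak m s1 m1 -> weak m1 s2 m' -> weak m (s1 ++ s2) m'.
Proof.
move=> [rho1 [<- f1]] [rho2 [<- f2]]; exists (rho1 ++ rho2).
by rewrite /word map_cat filter_cat; split=> //; apply: fires_cat f2.
Qed.

(** The run is cut around its first observable transition: induction on the run moves each leading
    silent transition into the first piece. *)
Lemma weak_cons_split m a s m' : weak m (a :: s) m' ->
  exists m1 m2, [/\ weak m [::] m1, Tform m1 m2 a & weak m2 s m'].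
Proof.
case=> rho []; elim: rho m => [//|t rho IH] m.
rewrite /word /=; case: eqP => [t0 /= w|t0 /= [<- ws]] [m1 [st f]].
  have [m2 [m3 [w2 T w3]]] := IH _ w f.
  exists m2, m3; split=> //; apply: (@weak_cat _ [::] m1 [::]) w2.
  by exists [:: t]; split; [rewrite /word /= t0 | exists m1].
exists m, m1; split; first exact: weak_refl.
  by have /stepE[en D] := st; exists t.
by exists rho.
Qed.

Lemma weak_cat_split m s1 s2 m' : weak m (s1 ++ s2) m' ->
  exists m1, weak m s1 m1 /\ weak m1 s2 m'.
Proof.
elim: s1 m => [|a s1 IH] m /=; first by exists m; split=> //; apply: weak_refl.
move=> /weak_cons_split[m1 [m2 [w1 [t [t0 en D ->]] w2]]].
have [m3 [w3 w4]] := IH _ w2; exists m3; split=> //.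
have st : step m1 t m2 by apply/stepE.
exact: weak_cat w1 (weak_cat (weak_step t0 st) w3).
Qed.

(** Since [0] is not a letter, the last transition of an [obs] run is not erased from its word. *)
Lemma obs_weak m s m' : ~ Sigma 0 -> obs m s m' -> weak m s m'.
Proof.
move=> S0 [|{}s a m1 t {}m' _ Sa ta w st]; first exact: weak_refl.
rewrite -cats1 -ta; apply: weak_cat w (weak_step _ st).
by move=> t0; apply: S0; rewrite -t0 ta.
Qed.

Context {C : presburger (places N)} {taus : presburger (places N + places N)}.
Hypothesis Htaus : is_tau_star C taus.

Lemma Tback_weak m m' a : holds C m -> Tback taus m m' a -> weak m [:: a] m'.
Proof.
move=> Cm [m1 [/(Htaus _ Cm) w [t [t0 en D ->]]]].
by apply: weak_cat w (weak_step t0 _); apply/stepE.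
Qed.

Lemma That_weak m m' a : holds C m -> a <> 0 -> That C taus m m' a ->
  weak m [:: a] m'.
Proof.
move=> Cm a0 [[m1 [/(Tback_weak Cm) w C1 /(Htaus _ C1)]]|[//]].
exact: weak_cat w.
Qed.

(** The first disjunct of [That] is impossible here, as [Tform] only fires transitions with nonzero
    label. *)
Lemma That0_weak m m' : holds C m -> That C taus m m' 0 -> weak m [::] m'.
Proof.
move=> Cm [[m1 [[m2 [_ [t [t0 _ _ e]]]] _ _]]|[_ /(Htaus _ Cm)//]].
by rewrite -e in t0.
Qed.

Hypothesis Hcore0 : core0 C taus.

(** Core 0 is applied to the prefix ending with the first observable transition; the silent run from
    the new [C]-marking back to the original one is absorbed into the rest of the run. *)
Lemma weak_cons_core m a s m' : holds C m -> weak m (a :: s) m' ->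
  exists m1, [/\ holds C m1, a <> 0, Tback taus m m1 a & weak m1 s m'].
Proof.
move=> Cm /weak_cons_split[x [y [/(Htaus _ Cm) mx T w]]].
have a0 : a <> 0 by case: T => t [t0 _ _ ->].
have [|m1 [C1 T1 /(Htaus _ C1) w1]] := Hcore0 (p := m) (p' := y) (a := a).
  by split=> //; exists x.
by exists m1; split=> //; apply: weak_cat w1 w.
Qed.

(** Induction removes the last letter, because [obs] singles out the last observable transition. *)
Lemma core0_coherent : ~ Sigma 0 -> coherent C.
Proof.
move=> S0 m s; elim/last_ind: s => [|s a IH] m' Cm Ss w.
  by exists m; split=> //; apply: obs_nil.
have Ss' : in_star Sigma s.
  by move=> b bs; apply: Ss; rewrite mem_rcons inE bs orbT.
have Sa : Sigma a by apply: Ss; rewrite mem_rcons mem_head.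
move: w; rewrite -cats1 => /weak_cat_split[x [/(IH _ Cm Ss')[y [Cy oy wy]] wx]].
(* The silent run left over from [s] is prepended to the run reading [a], which then starts in the
   [C]-marking [y]. *)
have /(weak_cons_core Cy)[z [Cz _ [u [/(Htaus _ Cy) yu [t [_ en D aE]]]] wz]] :
  weak y [:: a] m' by apply: weak_cat wy wx.
exists z; split=> //; rewrite cats1; apply: (@obs_rcons _ _ _ _ _ _ u t) => //.
  by rewrite -[s]cats0; apply: weak_cat yu; apply: obs_weak.
by apply/stepE.
Qed.

End NetRuns.

Theorem theorem3 (V : choiceType) (Sigma : nat -> Prop) (Sigma0 : ~ Sigma 0)
    (N1 N2 : net V Sigma)
    (C1 : presburger (places N1)) (C2 : presburger (places N2))
    (E : presburger (places N1 `|` places N2))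
    (taus1 : presburger (places N1 + places N1))
    (taus2 : presburger (places N2 + places N2))
    (Htaus1 : is_tau_star C1 taus1) (Htaus2 : is_tau_star C2 taus2)
    (Hcore0_1 : core0 C1 taus1) (Hcore0_2 : core0 C2 taus2)
    (Hcore1 : forall x : marking N1, holds C1 x ->
       exists y : marking N2, holds2 (tildeE E) x y /\ holds C2 y)
    (Hcore2 : forall (p1 : marking N1) (p2 : marking N2) (p1' : marking N1),
       holds2 (tildeE E) p1 p2 /\ tauform p1 p1' -> holds2 (tildeE E) p1' p2)
    (Hcore3 : forall (p1 : marking N1) (p2 : marking N2) (a : nat)
       (p1' : marking N1) (p2' : marking N2),
       [/\ holds C1 p1, holds2 (tildeE E) p1 p2, holds C2 p2,
           That C1 taus1 p1 p1' a & holds2 (tildeE E) p1' p2'] ->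
       That C2 taus2 p2 p2' a) :
  [/\ coherent C1, coherent C2 & preceq C1 C2 E].
Proof.
(* An empty word forces every transition of the run to be silent, so Core 2 applies once per
   transition. *)
have HS2 : S2 E.
  move=> m1 m1' [rho []]; elim: rho m1 => [m1 _ /= -> //|t rho IH] m1.
  rewrite /word /=; case: eqP => //= t0 w [m [/stepE[en D] f]] m2 e.
  by apply: IH w f _ _; apply: Hcore2; split; [exact: e | exists t].
split; [exact: core0_coherent Htaus1 _ _ | exact: core0_coherent Htaus2 _ _ |].
split=> // [m1 C1m|].
  by have [m2 [e C2m]] := Hcore1 _ C1m; exists m2.
move=> s m1 m1' _; elim: s m1 => [|a s IH] m1 w m2 m2' [C1m e C2m] e'.
  (* For the empty word, Core 3 is used at label [0], through the silent disjunct of [That]. *)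
  apply: (That0_weak Htaus2 C2m); apply: (Hcore3 m1 _ _ m1'); split=> //.
  by right; split=> //; apply/Htaus1.
have [x [C1x a0 T w']] := weak_cons_core Htaus1 Hcore0_1 C1m w.
have [y [exy C2y]] := Hcore1 _ C1x.
have wy : weak m2 [:: a] y.
  apply: (That_weak Htaus2 C2m a0); apply: (Hcore3 m1 _ _ x); split=> //.
  (* [x] already satisfies [C1], so the silent tail in [That] is the empty run. *)
  by left; exists x; split=> //; apply/Htaus1 => //; apply: weak_refl.
(* The pair [x], [y] is again related, so the induction hypothesis reads the remaining letters from
   it. *)
by apply: weak_cat wy _; apply: IH w' _ _ _ e'.
Qed.
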